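(* Let $f(x)=h(g(x))$ for $x\in\mathbb{R}^d$, where: (1) $g:\mathbb{R}^d\to\mathbb{R}$ is twice continuously differentiable, $\nabla g$ is $L_g$-Lipschitz continuous, and $g$ is $\mu_g$-PL with minimizer $x^*$ satisfying $g(x^* )=0$; (2) $h:[0,\infty)\to\mathbb{R}$ is twice continuously differentiable, strictly increasing and strictly convex, $h''$ is non-decreasing, and $h'(t)=\Theta(t^p)$ as $t\to0^+$ for some $p\ge1$. Let $L:\mathbb{R}^d\times(0,\infty)\to[0,\infty)$ be the local first-order smoothness oracle for $f$ given by $$L(x,R)=h''\left(\frac{[L_gR+\|\nabla g(x)\|]^2}{2\mu_g}\right)[L_gR+\|\nabla g(x)\|]^2+h'\left(\frac{[L_gR+\|\nabla g(x)\|]^2}{2\mu_g}\right)L_g.$$ Let $\eta\in(0,2)$ and let $(x_k)_{k\ge0}$ be generated from any starting point $x_0\in\mathbb{R}^d$ by Gradient Descent with LFSO, with this $L$, stepsize factor $\eta$, and $R_k=\|\nabla g(x_k)\|$ for all $k$. Then $\|\nabla f(x_k)\|\to0$ R-linearly.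
   Context: $\|\cdot\|$ is the Euclidean norm; $L_g,\mu_g>0$. That $g$ is $\mu_g$-PL (with minimum value $g(x^* )=0$) means $g(x)\le\frac{1}{2\mu_g}\|\nabla g(x)\|^2$ for all $x\in\mathbb{R}^d$. $h'(t)=\Theta(t^p)$ as $t\to0^+$ means there are $\delta>0$ and $0<C_1\le C_2$ with $C_1t^p\le h'(t)\le C_2t^p$ for all $t\in[0,\delta]$. A local first-order smoothness oracle (LFSO) for $f$ is a function $L:\mathbb{R}^d\times(0,\infty)\to[0,\infty)$, non-decreasing in its second argument, with $|f(y)-f(x)-\nabla f(x)^T(y-x)|\le \frac{L(x,R)}{2}\|y-x\|^2$ for all $x\in\mathbb{R}^d$, $R>0$ and $y$ with $\|y-x\|\le R$. Gradient Descent with LFSO: given $x_0\in\mathbb{R}^d$ and $\eta>0$, for $k=0,1,2,\ldots$ choose $R_k>0$, set $\widetilde{R}_k=\max\left\{R_k,\ \frac{\eta}{L(x_k,R_k)}\|\nabla f(x_k)\|\right\}$, and iterate $x_{k+1}=x_k-\frac{\eta}{L(x_k,\widetilde{R}_k)}\nabla f(x_k)$. Since the algorithm requires $R_k>0$, it is understood that $\nabla g(x_k)\ne0$ for all $k$. A nonnegative sequence $a_k\to0$ R-linearly if there are $C\ge0$ and $\rho\in(0,1)$ with $a_k\le C\rho^k$ for all $k\ge0$. *)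

(* Defs.v *)
From mathcomp Require Import all_boot all_order all_algebra.
From mathcomp Require Import all_classical all_reals all_analysis.

Set Implicit Arguments.
Unset Strict Implicit.
Unset Printing Implicit Defensive.

Import Order.TTheory GRing.Theory Num.Theory.
Import numFieldNormedType.Exports.

Local Open Scope classical_set_scope.
Local Open Scope ring_scope.

Section Euclidean.
Context {R : realType} {d : nat}.

Definition dotv (u v : 'rV[R]_d) : R := \sum_(i < d) u 0 i * v 0 i.

(* The library norm of 'rV[R]_d is the sup norm, hence this separate norm.
   Differentiability and continuity do not depend on which one is used. *)
Definition norm2 (u : 'rV[R]_d) : R := Num.sqrt (dotv u u).

Definition grad (f : 'rV[R]_d -> R) (x : 'rV[R]_d) : 'rV[R]_d :=
  \row_(i < d) 'D_(delta_mx 0 i) f x.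

(* 'J (grad g) x is the Hessian matrix of g at x. *)
Definition twice_continuously_differentiable (g : 'rV[R]_d -> R) : Prop :=
  [/\ forall x, differentiable g x,
      forall x, differentiable (grad g) x &
      continuous (fun x => 'J (grad g) x)].

Definition lipschitz2 (Lg : R) (F : 'rV[R]_d -> 'rV[R]_d) : Prop :=
  forall x y, norm2 (F x - F y) <= Lg * norm2 (x - y).

(* Polyak-Lojasiewicz inequality for a function with minimum value 0. *)
Definition PL (mu : R) (g : 'rV[R]_d -> R) : Prop :=
  forall x, g x <= (2 * mu)^-1 * norm2 (grad g x) ^+ 2.

(* A function on R^d x (0, +oo) is a total function whose values at R <= 0 are
   irrelevant. *)
Definition is_LFSO (f : 'rV[R]_d -> R) (L : 'rV[R]_d -> R -> R) : Prop :=
  [/\ forall x r, 0 < r -> 0 <= L x r,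
      forall x r s, 0 < r -> r <= s -> L x r <= L x s &
      forall x r y, 0 < r -> norm2 (y - x) <= r ->
        `|f y - f x - dotv (grad f x) (y - x)|
          <= L x r / 2 * norm2 (y - x) ^+ 2].

Definition Rtilde (f : 'rV[R]_d -> R) (L : 'rV[R]_d -> R -> R) (eta : R)
    (x : 'rV[R]_d) (r : R) : R :=
  Num.max r (eta / L x r * norm2 (grad f x)).

Definition GD_LFSO (f : 'rV[R]_d -> R) (L : 'rV[R]_d -> R -> R) (eta : R)
    (rad : nat -> R) (x : nat -> 'rV[R]_d) : Prop :=
  forall k, 0 < rad k /\
    x k.+1 = x k - (eta / L (x k) (Rtilde f L eta (x k) (rad k)))
                     *: grad f (x k).

End Euclidean.

(* Functions on [0, +oo) are represented by total functions R -> R whose values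
   at negative arguments are irrelevant; derivatives are relative to [0, +oo),
   hence one-sided at 0. *)
Section HalfLine.
Context {R : realType}.

Definition diffquo0y (h : R -> R) (t s : R) : R := s^-1 * (h (t + s) - h t).

Definition derivable0y (h : R -> R) (t : R) : Prop :=
  cvg (diffquo0y h t s @[s --> within [set s | 0 <= t + s] (0 : R)^']).

Definition derive0y (h : R -> R) (t : R) : R :=
  lim (diffquo0y h t s @[s --> within [set s | 0 <= t + s] (0 : R)^']).

Definition twice_continuously_differentiable0y (h : R -> R) : Prop :=
  [/\ forall t, 0 <= t -> derivable0y h t,
      forall t, 0 <= t -> derivable0y (derive0y h) t &
      {within `[0, +oo[, continuous (derive0y (derive0y h))}].

Definition strictly_increasing0y (h : R -> R) : Prop :=
  forall s t, 0 <= s -> s < t -> h s < h t.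

Definition nondecreasing0y (h : R -> R) : Prop :=
  forall s t, 0 <= s -> s <= t -> h s <= h t.

Definition strictly_convex0y (h : R -> R) : Prop :=
  forall s t a, 0 <= s -> 0 <= t -> s != t -> 0 < a -> a < 1 ->
    h (a * s + (1 - a) * t) < a * h s + (1 - a) * h t.

(* u(t) = Theta(t^p) as t -> 0+ *)
Definition Theta_pow0 (p : R) (u : R -> R) : Prop :=
  exists delta C1 C2 : R, [/\ 0 < delta, 0 < C1, C1 <= C2 &
    forall t, 0 <= t -> t <= delta ->
      C1 * t `^ p <= u t /\ u t <= C2 * t `^ p].

Definition R_linearly_to0 (a : nat -> R) : Prop :=
  exists C rho : R, [/\ 0 <= C, 0 < rho, rho < 1 &
    forall k, a k <= C * rho ^+ k].

End HalfLine.

Definition composite_LFSO {R : realType} {d : nat} (h : R -> R)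
    (g : 'rV[R]_d -> R) (Lg mu : R) (x : 'rV[R]_d) (r : R) : R :=
  let q := (Lg * r + norm2 (grad g x)) ^+ 2 in
  derive0y (derive0y h) (q / (2 * mu)) * q + derive0y h (q / (2 * mu)) * Lg.

(* Main.v *)
(** With t = g x, the PL inequality and smoothness make |grad g|^2 comparable to
    t, and h'' non-decreasing gives h''(t) t <= h'(2 t); hence along the iterates
    the oracle is at most a multiple of h'(D t), thus of h'(t) by the power law.
    The oracle inequality decreases f by at least a multiple of
    |grad f|^2 / L >= c h'(t) t >= c (f x - min f), which is a linear
    contraction of f - min f, and |grad f|^2 is bounded by a multiple of the
    decrease. *)

Require Import Defs.
From mathcomp Require Import all_boot all_order all_algebra.
From mathcomp Require Import all_classical all_reals all_analysis.
From mathcomp Require Import ring lra.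

Set Implicit Arguments.
Unset Strict Implicit.
Unset Printing Implicit Defensive.

Import Order.TTheory GRing.Theory Num.Theory.
Import numFieldNormedType.Exports.

Local Open Scope classical_set_scope.
Local Open Scope ring_scope.

(** * One-sided calculus on the half-line *)

Section HalfLineCalculus.
Context {R : realType}.
Implicit Types (u : R -> R) (a b t e : R).

Lemma derive0y_eps u t e : derivable0y u t -> 0 < e ->
  exists2 r, 0 < r & forall s, s != 0 -> `|s| < r -> 0 <= t + s ->
    `|derive0y u t - s^-1 * (u (t + s) - u t)| < e.
Proof.
move=> du e0.
have /cvgrPdist_lt/(_ e e0) : diffquo0y u t s @[s -->
  within [set s | 0 <= t + s] (0 : R)^'] --> derive0y u t by exact: du.
rewrite !near_withinE => /nbhs_ballP[r /= r0 H].
exists r => // s s0 sr ts0; apply: H => //=.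
by rewrite /ball /= sub0r normrN.
Qed.

(** For increments smaller than [t] the constraint [0 <= t + s] is void, so the relative derivative
    is the usual one. *)
Lemma is_derive_derive0y u t : 0 < t -> derivable0y u t ->
  is_derive t 1 u (derive0y u t).
Proof.
move=> t0 du.
have cv : h^-1 *: ((u \o shift t) (h *: (1 : R)) - u t) @[h --> 0^']
    --> derive0y u t.
  apply/cvgrPdist_lt => e e0; have [r r0 H] := derive0y_eps du e0.
  rewrite near_withinE; apply/nbhs_ballP.
  exists (Num.min r t) => /=; first by rewrite lt_min r0.
  move=> s; rewrite /ball /= sub0r normrN lt_min => /andP[sr st] s0.
  rewrite /= [_ *: 1]mulr1 [s + t]addrC; apply: H => //.
  by move: st; rewrite ltr_norml => /andP[? ?]; lra.
by split; [apply/cvg_ex; exists (derive0y u t) | exact: (cvg_lim _ cv)].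
Qed.

(** Difference quotients stay bounded by [K] near [a], hence [u s - u a] is at most [K * (s - a)] in
    absolute value. Only the right-hand side is considered, since at [a = 0] nothing is known on the
    left. *)
Lemma derivable0y_cvg_right u a : 0 <= a -> derivable0y u a ->
  u @ a^'+ --> u a.
Proof.
move=> a0 du; apply/cvgrPdist_lt => e e0.
have [r r0 H] := derive0y_eps du ltr01.
set K := `|derive0y u a| + 1.
have K0 : 0 < K by rewrite ltr_wpDl.
rewrite near_withinE; apply/nbhs_ballP.
exists (Num.min r (e / K)) => /=; first by rewrite lt_min r0 divr_gt0.
move=> s; rewrite /ball /= distrC lt_min => /andP[sr se] as_.
have s0 : 0 < s - a by rewrite subr_gt0.
have := H (s - a); rewrite gt_eqF// subrKC => /(_ isT sr (le_trans a0 (ltW as_))) Hs.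
set q := (s - a)^-1 * (u s - u a) in Hs.
have qK : `|q| < K.
  by rewrite -[q](subKr (derive0y u a)) (le_lt_trans (ler_normB _ _))// ltrD2l.
have -> : u a - u s = - ((s - a) * q) by rewrite /q mulVKf ?gt_eqF// opprB.
rewrite normrN normrM; rewrite ltr_pdivlMr// in se.
by apply: le_lt_trans se; rewrite ler_wpM2l// ltW.
Qed.

Lemma MVT0y u a b : 0 <= a -> a < b -> (forall t, 0 <= t -> derivable0y u t) ->
  exists2 c, a < c < b & u b - u a = derive0y u c * (b - a).
Proof.
move=> a0 ab du.
have dut t : a < t -> is_derive t 1 u (derive0y u t).
  by move=> at_; apply: is_derive_derive0y; [lra | apply: du; lra].
have cu t : a < t -> {for t, continuous u}.
  move=> /dut[dt _].
  by apply/differentiable_continuous/derivable1_diffP.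
have [||c] := @MVT R u (derive0y u) a b ab.
- by move=> t; rewrite in_itv/= => /andP[+ _]; exact: dut.
- apply/continuous_within_itvP => //; split.
  + by move=> t; rewrite in_itv/= => /andP[+ _]; exact: cu.
  + by apply: derivable0y_cvg_right => //; exact: du.
  + by apply: cvg_at_left_filter; exact: cu.
- by rewrite in_itv/=; exists c.
Qed.

End HalfLineCalculus.

(** * Inner product and Euclidean norm *)

Section EuclideanNorm.
Context {R : realType} {d : nat}.
Implicit Types (u v w : 'rV[R]_d) (a : R).

Lemma dotvC u v : dotv u v = dotv v u.
Proof. by apply: eq_bigr => i _; rewrite mulrC. Qed.

Lemma dotvDl u v w : dotv (u + v) w = dotv u w + dotv v w.
Proof. by rewrite -big_split; apply: eq_bigr => i _; rewrite mxE mulrDl. Qed.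

Lemma dotvZl a u v : dotv (a *: u) v = a * dotv u v.
Proof. by rewrite mulr_sumr; apply: eq_bigr => i _; rewrite mxE mulrA. Qed.

Lemma dotvDr u v w : dotv w (u + v) = dotv w u + dotv w v.
Proof. by rewrite dotvC dotvDl !(dotvC w). Qed.

Lemma dotvZr a u v : dotv u (a *: v) = a * dotv u v.
Proof. by rewrite dotvC dotvZl dotvC. Qed.

Lemma dotvNl u v : dotv (- u) v = - dotv u v.
Proof. by rewrite -scaleN1r dotvZl mulN1r. Qed.

Lemma dotvNr u v : dotv u (- v) = - dotv u v.
Proof. by rewrite dotvC dotvNl dotvC. Qed.

Lemma dotvv_ge0 u : 0 <= dotv u u.
Proof. by apply: sumr_ge0 => i _; rewrite -expr2 sqr_ge0. Qed.

Lemma norm2_ge0 u : 0 <= norm2 u.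
Proof. exact: sqrtr_ge0. Qed.

Lemma sqr_norm2 u : norm2 u ^+ 2 = dotv u u.
Proof. by rewrite sqr_sqrtr// dotvv_ge0. Qed.

Lemma norm2Z a u : norm2 (a *: u) = `|a| * norm2 u.
Proof.
by rewrite /norm2 dotvZl dotvZr mulrA -expr2 sqrtrM ?sqr_ge0// sqrtr_sqr.
Qed.

Lemma norm2N u : norm2 (- u) = norm2 u.
Proof. by rewrite -scaleN1r norm2Z normrN1 mul1r. Qed.

Lemma norm2_eq0 u : norm2 u = 0 -> u = 0.
Proof.
move=> /(congr1 (fun z => z ^+ 2)); rewrite sqr_norm2 expr0n/= => /eqP.
rewrite psumr_eq0 => [/allP u0|i _]; last by rewrite -expr2 sqr_ge0.
apply/rowP => i; rewrite mxE; apply/eqP.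
by have := u0 i (mem_index_enum _); rewrite mulf_eq0 orbb.
Qed.

(** Cauchy-Schwarz: expand the square of [norm2 v *: u - norm2 u *: v] and divide by
    [norm2 u * norm2 v], once the zero cases are removed. *)
Lemma ler_dotv_norm2 u v : dotv u v <= norm2 u * norm2 v.
Proof.
have [/norm2_eq0->|u0] := eqVneq (norm2 u) 0.
  by rewrite -(scale0r u) dotvZl norm2Z mul0r normr0 !mul0r.
have [/norm2_eq0->|v0] := eqVneq (norm2 v) 0.
  by rewrite -(scale0r u) dotvZr norm2Z mul0r normr0 mul0r mulr0.
have uv0 : 0 < norm2 u * norm2 v by rewrite mulr_gt0// lt_neqAle eq_sym norm2_ge0 andbT.
have := dotvv_ge0 (norm2 v *: u - norm2 u *: v).
rewrite dotvDl !dotvDr !dotvNl !dotvNr !dotvZl !dotvZr (dotvC v u) -!sqr_norm2.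
set nu := norm2 u in uv0 *; set nv := norm2 v in uv0 *; set x := dotv u v.
move=> H; rewrite -(ler_pM2l uv0); nra.
Qed.

Lemma ler_norm_dotv u v : `|dotv u v| <= norm2 u * norm2 v.
Proof.
rewrite ler_norml ler_dotv_norm2 andbT lerNl -dotvNl.
by rewrite (le_trans (ler_dotv_norm2 _ _))// norm2N.
Qed.

Lemma ler_norm2D u v : norm2 (u + v) <= norm2 u + norm2 v.
Proof.
rewrite -ler_sqr ?nnegrE ?addr_ge0 ?norm2_ge0//.
rewrite sqr_norm2 dotvDl !dotvDr (dotvC v u) sqrrD !sqr_norm2.
have := ler_dotv_norm2 u v; lra.
Qed.

End EuclideanNorm.

(** * Gradients along segments and the quadratic upper bound *)

Section Gradient.
Context {R : realType} {d : nat}.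
Implicit Types (F : 'rV[R]_d -> R) (x y v : 'rV[R]_d).

Lemma derive_dotv F x v : differentiable F x -> 'D_v F x = dotv (grad F x) v.
Proof.
move=> dF; rewrite deriveE// {1}(row_sum_delta v) linear_sum.
by apply: eq_bigr => i _; rewrite linearZ /= mxE deriveE// mulrC.
Qed.

Lemma is_derive_line F x v (s : R) : differentiable F (x + s *: v) ->
  is_derive s 1 (fun s => F (x + s *: v)) (dotv (grad F (x + s *: v)) v).
Proof.
move=> dF; have [dv e] : is_derive (x + s *: v) v F
    (dotv (grad F (x + s *: v)) v).
  by rewrite -derive_dotv//; apply/derivableP/diff_derivable.
have E : (fun h => h^-1 *: (((fun s => F (x + s *: v)) \o shift s) (h *: (1 : R))
    - F (x + s *: v))) =
  (fun h => h^-1 *: ((F \o shift (x + s *: v)) (h *: v) - F (x + s *: v))).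
  apply/funext => h /=; congr (_ *: (F _ - _)).
  by rewrite [_ *: 1]mulr1 scalerDl addrCA.
by split; rewrite /derivable /derive E.
Qed.

Lemma mvt_grad F x v : (forall z, differentiable F z) ->
  exists2 s : R, 0 < s < 1 & F (x + v) - F x = dotv (grad F (x + s *: v)) v.
Proof.
move=> dF; pose phi s := F (x + s *: v).
have dphi (s : R) : is_derive s 1 phi (dotv (grad F (x + s *: v)) v).
  exact: is_derive_line.
have [|s] := @MVT R phi _ 0 1 ltr01 (fun s _ => dphi s).
  by apply: derivable_within_continuous => s _; case: (dphi s).
rewrite in_itv/= => s01; rewrite /phi scale1r scale0r addr0 subr0 mulr1 => E.
by exists s.
Qed.

(** The descent lemma, with the Lipschitz bound required only between [x] and points of the segment,
    so that [M] may be a local constant. *)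
Lemma quadratic_bound F (M : R) x v : (forall z, differentiable F z) ->
  (forall s : R, 0 < s < 1 ->
    norm2 (grad F (x + s *: v) - grad F x) <= M * (s * norm2 v)) ->
  `|F (x + v) - F x - dotv (grad F x) v| <= M / 2 * norm2 v ^+ 2.
Proof.
move=> dF HM.
(* The sign [e] covers both halves of the absolute value. *)
have key (e : R) : `|e| = 1 ->
    e * (F (x + v) - F x - dotv (grad F x) v) <= M / 2 * norm2 v ^+ 2.
  move=> e1.
  (* The increment of [phi] over [0, 1] is the left side minus the right side. Its derivative is
     nonpositive on (0, 1) by Cauchy-Schwarz and [HM], so the mean value theorem replaces an
     integral. *)
  pose phi (s : R) := e * (F (x + s *: v) - s * dotv (grad F x) v)
    - M / 2 * norm2 v ^+ 2 * s ^+ 2.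
  have dphi (s : R) : is_derive s 1 phi
      (e * dotv (grad F (x + s *: v) - grad F x) v
        - M * norm2 v ^+ 2 * s).
    have := is_derive_line (dF (x + s *: v)) => ?.
    have ? : is_derive s 1 (fun s => s * dotv (grad F x) v) (dotv (grad F x) v).
      apply: is_derive_eq; rewrite /GRing.scale/=; ring.
    apply: is_derive_eq; rewrite dotvDl dotvNl /GRing.scale/=; by field.
  have [|s] := @MVT R phi _ 0 1 ltr01 (fun s _ => dphi s).
    by apply: derivable_within_continuous => s _; case: (dphi s).
  rewrite in_itv/= => s01; rewrite /phi scale1r scale0r addr0 subr0 mulr1 => E.
  suff : e * dotv (grad F (x + s *: v) - grad F x) v - M * norm2 v ^+ 2 * s <= 0.
    by rewrite -E; lra.
  rewrite subr_le0 (le_trans (ler_norm _))// normrM e1 mul1r.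
  rewrite (le_trans (ler_norm_dotv _ _))//.
  apply: le_trans (ler_wpM2r (norm2_ge0 _) (HM s s01)) _.
  by lra.
have := key 1; have := key (-1); rewrite normrN1 normr1 => /(_ erefl) + /(_ erefl).
by rewrite ler_norml; lra.
Qed.

End Gradient.

(** * Properties of the outer function [h] and its derivatives *)

Section Profile.
Context {R : realType} (h : R -> R) (p : R).
Implicit Types s t D M T : R.
Context (hC2 : twice_continuously_differentiable0y h).
Context (h2_nd : nondecreasing0y (derive0y (derive0y h))).
Context (p_ge1 : 1 <= p) (h1_Theta : Theta_pow0 p (derive0y h)).

Local Notation h1 := (derive0y h).
Local Notation h2 := (derive0y (derive0y h)).

Let h_derivable t : 0 <= t -> derivable0y h t.
Proof. by case: hC2 => + _ _; exact. Qed.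

Let h1_derivable t : 0 <= t -> derivable0y h1 t.
Proof. by case: hC2 => _ + _; exact. Qed.

(** Both power bounds hold at [t = 0] and vanish there, since [p] is nonzero. *)
Lemma derive0y_0 : derive0y h 0 = 0.
Proof.
have [r [C1 [C2 [r0 _ _ H]]]] := h1_Theta.
have := H 0 (lexx _) (ltW r0); rewrite powR0 ?gt_eqF ?(lt_le_trans ltr01)//.
by rewrite !mulr0 => -[? ?]; apply/eqP; rewrite eq_le; apply/andP.
Qed.

(** By monotonicity only the value at 0 matters. Were it negative, the quotients [h1 s / s] would be
    negative for small [s > 0], against the lower power bound. *)
Lemma derive0y2_ge0 t : 0 <= t -> 0 <= derive0y (derive0y h) t.
Proof.
move=> t0; suff : 0 <= h2 0 by move=> /le_trans; apply; exact: h2_nd.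
rewrite leNgt; apply/negP => h20.
have [r [C1 [C2 [r0 C10 _ H]]]] := h1_Theta.
have [r' r'0 H'] := derive0y_eps (h1_derivable (lexx 0)) (e := - h2 0) ltac:(lra).
set s := Num.min r r' / 2.
have m0 : 0 < Num.min r r' by rewrite lt_min r0.
have mr : Num.min r r' <= r by rewrite ge_min lexx.
have mr' : Num.min r r' <= r' by rewrite ge_min lexx orbT.
have s0 : 0 < s by rewrite /s; lra.
have sr' : `|s| < r' by rewrite gtr0_norm// /s; lra.
have := H' s; rewrite gt_eqF// add0r => /(_ isT sr' (ltW s0)).
rewrite derive0y_0 subr0 => Hs.
have [hs _] := H s (ltW s0) ltac:(rewrite /s; lra).
have : 0 <= s^-1 * h1 s.
  by rewrite mulr_ge0 ?invr_ge0 ?(ltW s0)// (le_trans _ hs)// mulr_ge0 ?powR_ge0// ltW.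
by move: Hs; rewrite ltr_norml; lra.
Qed.

Lemma derive0y_nd : nondecreasing0y (derive0y h).
Proof.
move=> s t s0; rewrite le_eqVlt => /predU1P[->//|st].
have [c /andP[sc ct] E] := MVT0y s0 st h1_derivable.
rewrite -subr_ge0 E mulr_ge0 ?subr_ge0 ?(ltW st)//.
by apply: derive0y2_ge0; lra.
Qed.

(** The lower power bound gives positivity near 0, and monotonicity carries it to larger [t]. *)
Lemma derive0y_gt0 t : 0 < t -> 0 < derive0y h t.
Proof.
move=> t0; have [r [C1 [C2 [r0 C10 _ H]]]] := h1_Theta.
have m0 : 0 < Num.min r t by rewrite lt_min r0.
have [hm _] := H (Num.min r t) (ltW m0) ltac:(by rewrite ge_min lexx).
rewrite (lt_le_trans _ (derive0y_nd (ltW m0) (_ : _ <= t)))//; last first.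
  by rewrite ge_min lexx orbT.
by rewrite (lt_le_trans _ hm)// mulr_gt0// powR_gt0.
Qed.

Lemma derive0y_ge0 t : 0 <= t -> 0 <= derive0y h t.
Proof. by move=> t0; rewrite -derive0y_0; exact: derive0y_nd. Qed.

Lemma derive0y_lipschitz T s t : 0 <= s <= T -> 0 <= t <= T ->
  `|derive0y h s - derive0y h t| <= derive0y (derive0y h) T * `|s - t|.
Proof.
wlog st : s t / s <= t.
  move=> W sT tT; have [/W|/ltW/W] := leP s t; first exact.
  by rewrite distrC (distrC s); exact.
move: st; rewrite le_eqVlt => /predU1P[->|st] /andP[s0 sT] /andP[t0 tT].
  by rewrite !subrr normr0 mulr0.
have [c /andP[sc ct] E] := MVT0y s0 st h1_derivable.
have c0 : 0 <= c by lra.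
rewrite distrC E normrM (distrC s) ger0_norm ?derive0y2_ge0// ler_wpM2r//.
by apply: h2_nd => //; lra.
Qed.

(** By the mean value theorem on [t, 2t], [h1 (2 * t) = h1 t + h2 c * t] with [c > t]; then
    [h1 t >= 0] and [h2 c >= h2 t]. *)
Lemma mul_derive0y2_le t : 0 < t ->
  t * derive0y (derive0y h) t <= derive0y h (2 * t).
Proof.
move=> t0; have t2 : t < 2 * t by lra.
have [c /andP[tc _] E] := MVT0y (ltW t0) t2 h1_derivable.
have := derive0y_ge0 (ltW t0); have := h2_nd (ltW t0) (ltW tc).
have -> : h1 (2 * t) = h1 t + h2 c * t by rewrite -[LHS](subrK (h1 t)) E; ring.
nra.
Qed.

Lemma sub_le_derive0y t : 0 <= t -> h t - h 0 <= t * derive0y h t.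
Proof.
rewrite le_eqVlt => /predU1P[<-|t0]; first by rewrite subrr mul0r.
have [c /andP[c0 ct] ->] := MVT0y (lexx 0) t0 h_derivable.
by rewrite subr0 mulrC ler_wpM2l ?(ltW t0)//; apply: derive0y_nd; exact: ltW.
Qed.

(* Near 0 this is the power law; away from 0, [derive0y h] is bounded between
   two positive constants on a bounded interval. *)
Lemma derive0y_doubling D M : 1 <= D -> 0 < M ->
  exists2 K, 0 < K &
    forall t, 0 < t <= M -> derive0y h (D * t) <= K * derive0y h t.
Proof.
move=> D1 M0; have [r [C1 [C2 [r0 C10 C12 H]]]] := h1_Theta.
have D0 : 0 < D by lra.
have rD0 : 0 < r / D by rewrite divr_gt0.
have hr := derive0y_gt0 rD0; have hM := derive0y_gt0 (mulr_gt0 D0 M0).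
(* [K1] serves [t <= r / D], where both [t] and [D * t] lie in the power-law range; [K2] compares
   the extreme values for the other [t]. *)
set K1 := C2 / C1 * D `^ p; set K2 := derive0y h (D * M) / derive0y h (r / D).
have K10 : 0 < K1 by rewrite /K1 mulr_gt0 ?powR_gt0// divr_gt0//; lra.
have K20 : 0 < K2 by rewrite /K2 divr_gt0.
exists (K1 + K2); first by rewrite addr_gt0.
move=> t /andP[t0 tM]; have ht := derive0y_gt0 t0.
rewrite mulrDl; have [tr|rt] := leP t (r / D).
  have Dt : D * t <= r by rewrite mulrC -ler_pdivlMr.
  have [_ up] := H (D * t) (ltW (mulr_gt0 D0 t0)) Dt.
  have [lo _] : C1 * t `^ p <= derive0y h t /\ derive0y h t <= C2 * t `^ p.
    by apply: H; [exact: ltW | nra].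
  rewrite (le_trans up)// powRM ?(ltW D0) ?(ltW t0)//.
  have -> : C2 * (D `^ p * t `^ p) = K1 * (C1 * t `^ p) by rewrite /K1; field; lra.
  have := ler_wpM2l (ltW K10) lo; have := mulr_gt0 K20 ht; lra.
have hrt := derive0y_nd (ltW rD0) (ltW rt).
have hDM : derive0y h (D * t) <= derive0y h (D * M).
  by apply: derive0y_nd; [rewrite mulr_ge0// ltW | rewrite ler_pM2l].
have E : derive0y h (D * M) = K2 * derive0y h (r / D).
  by rewrite /K2 divfK// gt_eqF.
have := ler_wpM2l (ltW K20) hrt; have := mulr_gt0 K10 ht; lra.
Qed.

(* The zero slope at 0 makes the constant extension of [h] to the left
   differentiable. *)
Lemma is_derive_extend0y t : 0 <= t ->
  is_derive t 1 (fun s => h (Num.max s 0)) (derive0y h t).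
Proof.
move=> t0; set H := fun s => h (Num.max s 0).
have cv : s^-1 *: ((H \o shift t) (s *: (1 : R)) - H t) @[s --> 0^']
    --> derive0y h t.
  apply/cvgrPdist_lt => e e0.
  have [r r0 Hr] := derive0y_eps (h_derivable t0) e0.
  rewrite near_withinE; apply/nbhs_ballP.
  (* For [t > 0] a radius at most [t] keeps [t + s] nonnegative; at [t = 0] that minimum would be
     0. *)
  exists (if t == 0 then r else Num.min r t) => /=.
    case: eqVneq => // tn0; rewrite lt_min r0 lt_neqAle eq_sym tn0//.
  move=> s; rewrite /ball /= sub0r normrN => sr s0.
  rewrite /= [_ *: 1]mulr1 [s + t]addrC /H (max_idPl t0).
  have [ts0|ts0] := leP 0 (t + s).
    apply: Hr => //; move: sr; case: eqP => // _.
    by rewrite lt_min => /andP[].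
  suff te : t = 0 by rewrite te subrr scaler0 derive0y_0 subr0 normr0.
  move: sr; case: eqVneq => // tn0; rewrite lt_min => /andP[_].
  by rewrite ltr_norml => /andP[? ?]; lra.
by split; [apply/cvg_ex; exists (derive0y h t) | exact: (cvg_lim _ cv)].
Qed.

(** * Chain rule for [h \o g] *)

Section Composite.
Context {d : nat} (g : 'rV[R]_d -> R).
Context (g_diff : forall x, differentiable g x) (g_ge0 : forall x, 0 <= g x).

(** Replaces [h] by an extension with two-sided derivatives at every value of [g], to which the
    ordinary chain rule applies. *)
Let compE : h \o g = (fun s => h (Num.max s 0)) \o g.
Proof. by apply/funext => x /=; rewrite (max_idPl (g_ge0 x)). Qed.

Let ext_differentiable x :
  differentiable (fun s => h (Num.max s 0)) (g x).
Proof. by apply/derivable1_diffP; case: (is_derive_extend0y (g_ge0 x)). Qed.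

Lemma differentiable_composite x : differentiable (h \o g) x.
Proof. by rewrite compE; exact: differentiable_comp. Qed.

Lemma grad_composite x : grad (h \o g) x = derive0y h (g x) *: grad g x.
Proof.
apply/rowP => i; rewrite !mxE !deriveE//; last exact: differentiable_composite.
rewrite compE diff_comp//= diff1E// derive1E.
by case: (is_derive_extend0y (g_ge0 x)) => _ ->; rewrite mulrC.
Qed.

End Composite.

End Profile.

(** A gradient step with stepsize [Lg^-1] lowers [g] by at least [norm2 (grad g x) ^+ 2 / (2 * Lg)],
    yet [g] stays nonnegative. *)
Lemma sqr_norm2_grad_le {R : realType} {d : nat} (g : 'rV[R]_d -> R) (Lg : R) x :
  0 < Lg -> (forall x, differentiable g x) -> lipschitz2 Lg (grad g) ->
  (forall x, 0 <= g x) -> norm2 (grad g x) ^+ 2 <= 2 * Lg * g x.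
Proof.
move=> Lg0 dg g_lip g0; set v := - Lg^-1 *: grad g x.
have nv : norm2 v = Lg^-1 * norm2 (grad g x).
  by rewrite norm2Z normrN ger0_norm// invr_ge0 ltW.
have : `|g (x + v) - g x - dotv (grad g x) v| <= Lg / 2 * norm2 v ^+ 2.
  apply: quadratic_bound => // s /andP[s0 _].
  by rewrite (le_trans (g_lip _ _))// addrC addKr norm2Z gtr0_norm.
rewrite nv dotvZr -sqr_norm2 ler_norml => /andP[_].
set G := norm2 _; have := g0 (x + v).
have -> : Lg / 2 * (Lg^-1 * G) ^+ 2 = G ^+ 2 / (2 * Lg) by field; lra.
have -> : - Lg^-1 * G ^+ 2 = - 2 * (G ^+ 2 / (2 * Lg)) by field; lra.
move=> g1 H; have : G ^+ 2 / (2 * Lg) <= g x by lra.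
by rewrite ler_pdivrMr 1?mulrC//; lra.
Qed.

(** Taking square roots turns the ratio [rho] into [Num.sqrt rho]; the contraction of function
    values controls only squared gradient norms. *)
Lemma R_linearly_to0_sqr {R : realType} (a : nat -> R) (B rho : R) :
  0 < rho < 1 -> (forall k, a k ^+ 2 <= B * rho ^+ k) -> R_linearly_to0 a.
Proof.
move=> /andP[r0 r1] H.
have B0 : 0 <= B by have := H 0%N; rewrite expr0 mulr1; apply: le_trans (sqr_ge0 _).
exists (Num.sqrt B), (Num.sqrt rho); split.
- exact: sqrtr_ge0.
- by rewrite sqrtr_gt0.
- by rewrite -[ltRHS]sqrtr1 ltr_sqrt.
- move=> k; rewrite (le_trans (ler_norm _))//.
  rewrite -ler_sqr ?nnegrE ?mulr_ge0 ?exprn_ge0 ?sqrtr_ge0//.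
  by rewrite real_normK ?num_real// exprMn -exprM mulnC exprM !sqr_sqrtr// ltW.
Qed.

(** * The composite oracle: monotonicity, lower bound and validity *)

Section CompositeOracle.
Context {R : realType} {d : nat} (g : 'rV[R]_d -> R) (h : R -> R).
Context (Lg mug p : R) (Lg_gt0 : 0 < Lg) (mug_gt0 : 0 < mug).
Context (g_diff : forall x, differentiable g x) (g_lip : lipschitz2 Lg (grad g)).
Context (g_PL : PL mug g) (g_ge0 : forall x, 0 <= g x).
Context (hC2 : twice_continuously_differentiable0y h).
Context (h_incr : strictly_increasing0y h).
Context (h2_nd : nondecreasing0y (derive0y (derive0y h))).
Context (p_ge1 : 1 <= p) (h1_Theta : Theta_pow0 p (derive0y h)).

Local Notation f := (h \o g).
Local Notation L := (composite_LFSO h g Lg mug).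
Local Notation h1 := (derive0y h).
Local Notation h2 := (derive0y (derive0y h)).
Implicit Types (x v : 'rV[R]_d) (r s t : R).

Let h1_ge0 := derive0y_ge0 hC2 h2_nd p_ge1 h1_Theta.
Let h1_gt0 := derive0y_gt0 hC2 h2_nd p_ge1 h1_Theta.
Let h1_nd := derive0y_nd hC2 h2_nd p_ge1 h1_Theta.
Let h2_ge0 := derive0y2_ge0 hC2 h2_nd p_ge1 h1_Theta.
Let h1_lip := derive0y_lipschitz hC2 h2_nd p_ge1 h1_Theta.
Let f_diff := differentiable_composite hC2 p_ge1 h1_Theta g_diff g_ge0.
Let f_grad := grad_composite hC2 p_ge1 h1_Theta g_diff g_ge0.

Let norm2_gradf x : norm2 (grad f x) = h1 (g x) * norm2 (grad g x).
Proof. by rewrite f_grad norm2Z ger0_norm// h1_ge0. Qed.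

Lemma composite_LFSO_nd x r s : 0 <= r -> r <= s -> L x r <= L x s.
Proof.
move=> r0 rs; rewrite /composite_LFSO.
set G := norm2 _; have G0 : 0 <= G := norm2_ge0 _.
have m0 : 0 < 2 * mug by rewrite mulr_gt0.
have [nr ns] : 0 <= Lg * r + G /\ Lg * r + G <= Lg * s + G.
  by rewrite addr_ge0 ?mulr_ge0 ?(ltW Lg_gt0)// lerD2r ler_wpM2l ?(ltW Lg_gt0).
have q0 : 0 <= (Lg * r + G) ^+ 2 / (2 * mug) by rewrite divr_ge0 ?sqr_ge0// ltW.
have qle : (Lg * r + G) ^+ 2 <= (Lg * s + G) ^+ 2.
  by rewrite ler_sqr ?nnegrE// (le_trans nr).
have tle : (Lg * r + G) ^+ 2 / (2 * mug) <= (Lg * s + G) ^+ 2 / (2 * mug).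
  by rewrite ler_wpM2r// invr_ge0 ltW.
apply: lerD; last by rewrite ler_wpM2r ?(ltW Lg_gt0)//; exact: h1_nd.
by apply: ler_pM; rewrite ?sqr_ge0 ?h2_ge0//; exact: h2_nd.
Qed.

(** PL puts [g x] below the argument of [h1] in the oracle, and the [h2] term is nonnegative. This
    gives positivity of the oracle and controls [Rtilde]. *)
Lemma composite_LFSO_lb x r : 0 <= r -> Lg * h1 (g x) <= L x r.
Proof.
move=> r0; rewrite /composite_LFSO.
set G := norm2 _; have G0 : 0 <= G := norm2_ge0 _.
set q := (Lg * r + G) ^+ 2.
have q0 : 0 <= q / (2 * mug).
  by apply: divr_ge0; [exact: sqr_ge0 | rewrite mulr_ge0 ?(ltW mug_gt0)].
have gq : g x <= q / (2 * mug).
  rewrite (le_trans (g_PL x))// mulrC ler_wpM2r ?invr_ge0 ?mulr_ge0 ?(ltW mug_gt0)//.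
  have GQ : G <= Lg * r + G by rewrite lerDr mulr_ge0 ?(ltW Lg_gt0).
  by rewrite ler_sqr ?nnegrE// (le_trans G0).
have := h1_nd (g_ge0 x) gq; have := mulr_ge0 (h2_ge0 q0) (sqr_ge0 (Lg * r + G)).
by rewrite -/q => ? /(ler_wpM2l (ltW Lg_gt0)); lra.
Qed.

Lemma composite_LFSO_ge0 x r : 0 <= r -> 0 <= L x r.
Proof.
move=> /(composite_LFSO_lb x); apply: le_trans.
by rewrite mulr_ge0 ?h1_ge0// ltW.
Qed.

(* Split [grad f z - grad f x] as [h'(g z) (grad g z - grad g x)
   + (h'(g z) - h'(g x)) grad g x]; the PL inequality keeps the values of [g]
   on the segment below the argument of [h'] and [h''] in the oracle. *)
Lemma lipschitz_grad_composite x r v s : norm2 v <= r -> 0 < s < 1 ->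
  norm2 (grad f (x + s *: v) - grad f x) <= L x r * (s * norm2 v).
Proof.
have Lg0 := Lg_gt0; move=> vr /andP[s0 s1]; set z := x + s *: v.
set G := norm2 (grad g x); set Q := Lg * r + G; set T := Q ^+ 2 / (2 * mug).
have G0 : 0 <= G := norm2_ge0 _.
have v0 := norm2_ge0 v.
have r0 : 0 <= r by lra.
have GQ : G <= Q by rewrite /Q lerDr mulr_ge0// ltW.
have Q0 : 0 <= Q by lra.
have gradQ t : 0 <= t <= 1 -> norm2 (grad g (x + t *: v)) <= Q.
  move=> /andP[t0 t1].
  rewrite -[grad g _](subrK (grad g x)) (le_trans (ler_norm2D _ _))// lerD2r.
  rewrite (le_trans (g_lip _ _))// addrC addKr norm2Z ger0_norm//.
  by rewrite ler_wpM2l ?(ltW Lg0)// (le_trans _ vr)// ler_piMl.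
have gT t : 0 <= t <= 1 -> g (x + t *: v) <= T.
  move=> /gradQ tQ; rewrite (le_trans (g_PL _))// mulrC ler_wpM2r//.
    by rewrite invr_ge0 mulr_ge0// ltW.
  by rewrite ler_sqr ?nnegrE ?norm2_ge0.
have gx : g x <= T by have := gT 0 ltac:(lra); rewrite scale0r addr0.
have gz : g z <= T by apply: gT; lra.
(* The intermediate point is [x + (t * s) *: v], still on the segment, so [gradQ] bounds the
   gradient there. *)
have g_inc : `|g z - g x| <= Q * (s * norm2 v).
  have [t /andP[t0 t1] ->] := mvt_grad x (s *: v) g_diff.
  rewrite (le_trans (ler_norm_dotv _ _))// norm2Z gtr0_norm//.
  rewrite ler_wpM2r ?mulr_ge0 ?(ltW s0)// scalerA; apply: gradQ.
  by rewrite mulr_ge0 ?ltW//=; nra.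
have -> : grad f z - grad f x = h1 (g z) *: (grad g z - grad g x)
    + (h1 (g z) - h1 (g x)) *: grad g x.
  by rewrite !f_grad scalerBr scalerBl addrA subrK.
rewrite (le_trans (ler_norm2D _ _))// !norm2Z (ger0_norm (h1_ge0 (g_ge0 z))).
have A1 : h1 (g z) * norm2 (grad g z - grad g x) <= h1 T * (Lg * (s * norm2 v)).
  apply: ler_pM; rewrite ?norm2_ge0 ?h1_ge0//; first exact: h1_nd.
  by rewrite (le_trans (g_lip _ _))// addrC addKr norm2Z gtr0_norm.
have A2 : `|h1 (g z) - h1 (g x)| * norm2 (grad g x)
    <= h2 T * (Q * (s * norm2 v)) * Q.
  apply: ler_pM; rewrite ?norm2_ge0//.
  rewrite (le_trans (h1_lip (T := T) _ _)) ?g_ge0//.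
  by rewrite ler_wpM2l// h2_ge0// (le_trans (g_ge0 x)).
rewrite /composite_LFSO -/G -/Q -/T; apply: le_trans (lerD A1 A2) _; lra.
Qed.

Lemma composite_is_LFSO : is_LFSO f L.
Proof.
split.
- by move=> x r r0; apply: composite_LFSO_ge0; exact: ltW.
- by move=> x r s r0; apply: composite_LFSO_nd; exact: ltW.
- move=> x r y r0 yr; rewrite -{1}[y](subrKC x).
  apply: quadratic_bound => // s s01.
  exact: lipschitz_grad_composite.
Qed.

(** * Descent along the iterates and linear contraction *)

Section Descent.
Context (eta : R) (eta_gt0 : 0 < eta) (eta_lt2 : eta < 2).

Local Notation rt x := (Rtilde f L eta x (norm2 (grad g x))).

Let rt_ge x : norm2 (grad g x) <= rt x.
Proof. by rewrite /Rtilde le_max lexx. Qed.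

Let rt_ge0 x : 0 <= rt x.
Proof. by rewrite (le_trans (norm2_ge0 _) (rt_ge x)). Qed.

(** The squared gradient norm is at most [2 * Lg * g x], so the gradient vanishes wherever [g]
    does. *)
Let g_gt0 x : 0 < norm2 (grad g x) -> 0 < g x.
Proof.
move=> G0; have := sqr_norm2_grad_le x Lg_gt0 g_diff g_lip g_ge0.
have : 0 < norm2 (grad g x) ^+ 2 by rewrite exprn_gt0.
by move=> /lt_le_trans/[apply]; rewrite pmulr_rgt0 ?mulr_gt0.
Qed.

Let L_gt0 x r : 0 < norm2 (grad g x) -> 0 <= r -> 0 < L x r.
Proof.
move=> /g_gt0/h1_gt0 g0 r0.
by rewrite (lt_le_trans _ (composite_LFSO_lb x r0))// mulr_gt0.
Qed.

Lemma descent_step x : 0 < norm2 (grad g x) ->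
  f (x - (eta / L x (rt x)) *: grad f x)
    <= f x - eta * (1 - eta / 2) / L x (rt x) * norm2 (grad f x) ^+ 2.
Proof.
move=> G0; set l := L x (rt x); have l0 : 0 < l by exact: L_gt0.
have L00 : 0 < L x (norm2 (grad g x)) by rewrite L_gt0// norm2_ge0.
set v := - (eta / l) *: grad f x.
have nv : norm2 v = eta / l * norm2 (grad f x).
  by rewrite norm2Z normrN ger0_norm// divr_ge0// ltW.
rewrite -scaleNr -/v.
(* This is the purpose of [Rtilde]: the oracle grows with the radius, so the step taken is no longer
   than the trial step, and it stays in the ball where [l] is valid. *)
have vr : norm2 v <= rt x.
  rewrite nv /Rtilde le_max; apply/orP; right.
  rewrite ler_wpM2r ?norm2_ge0// ler_wpM2l ?(ltW eta_gt0)//.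
  by rewrite lef_pV2// composite_LFSO_nd// norm2_ge0.
have := quadratic_bound f_diff (fun s => lipschitz_grad_composite x (s := s) vr).
rewrite -/l nv dotvZr -sqr_norm2 ler_norml => /andP[_].
set N := norm2 _.
have -> : l / 2 * (eta / l * N) ^+ 2 = eta / 2 * (eta / l * N ^+ 2).
  by field; lra.
have -> : eta * (1 - eta / 2) / l * N ^+ 2
    = (1 - eta / 2) * (eta / l * N ^+ 2) by field; lra.
lra.
Qed.

Let c := Num.max 1 (2 / Lg).

(** The trial step has length [eta * h1 (g x) / L] times the gradient norm of [g];
    [composite_LFSO_lb] and [eta < 2] bound this factor by [2 / Lg]. *)
Let rt_le x : 0 < norm2 (grad g x) -> rt x <= c * norm2 (grad g x).
Proof.
move=> G0; have c1 : 1 <= c by rewrite /c le_max lexx.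
have cL : 2 / Lg <= c by rewrite /c le_max lexx orbT.
have h10 := h1_gt0 (g_gt0 G0).
have l0 : 0 < L x (norm2 (grad g x)) by apply: L_gt0 => //; exact: ltW.
rewrite /Rtilde ge_max ler_peMl ?norm2_ge0//= norm2_gradf mulrA ler_pM2r//.
rewrite (le_trans _ cL)// mulrAC ler_pdivrMr// mulrAC ler_pdivlMr//.
have := composite_LFSO_lb x (ltW G0).
have := ler_wpM2r (ltW (mulr_gt0 Lg_gt0 h10)) (ltW eta_lt2); lra.
Qed.

(* Here [h''(t) t <= h'(2 t)] removes the second derivative from the oracle and
   [|grad g|^2 <= 2 Lg g] turns its argument into a multiple of [g x]. *)
Lemma composite_LFSO_Rtilde_le M : 0 < M -> exists2 A, 0 < A &
  forall x, 0 < norm2 (grad g x) -> g x <= M -> L x (rt x) <= A * h1 (g x).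
Proof.
move=> M0; have [Lg0 mu0] := (Lg_gt0, mug_gt0).
(* At radius [c * norm2 (grad g x)] the oracle evaluates [h1] and [h2] at [t = B * norm2 (grad g x)
   ^+ 2 / (2 * mug)], and [D] is chosen so that [2 * t <= D * g x]. The 1 in the maximum serves the
   doubling lemma. *)
set B := (Lg * c + 1) ^+ 2; set D := Num.max 1 (2 * Lg * B / mug).
have D1 : 1 <= D by rewrite /D le_max lexx.
have DB : 2 * Lg * B / mug <= D by rewrite /D le_max lexx orbT.
have [K K0 HK] := derive0y_doubling hC2 h2_nd p_ge1 h1_Theta D1 M0.
(* The enlarged oracle is [2 * mug * (t * h2 t) + Lg * h1 t], and both [t * h2 t] and [h1 t] are at
   most [h1 (2 * t)]. *)
exists ((2 * mug + Lg) * K); first by rewrite mulr_gt0//; lra.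
move=> x G0 gM; have g0 := g_gt0 G0.
rewrite (le_trans (composite_LFSO_nd x (rt_ge0 x) (rt_le G0)))//.
rewrite /composite_LFSO.
have -> : Lg * (c * norm2 (grad g x)) + norm2 (grad g x)
  = (Lg * c + 1) * norm2 (grad g x) by ring.
rewrite exprMn -/B; set t := _ / _.
have c1 : 1 <= c by rewrite /c le_max lexx.
have B0 : 0 < B by rewrite /B exprn_gt0// addr_gt0// mulr_gt0//; lra.
have t0 : 0 < t.
  by apply: divr_gt0; apply: mulr_gt0 => //; exact: exprn_gt0.
have E : B * norm2 (grad g x) ^+ 2 = 2 * mug * t by rewrite /t; field; lra.
rewrite E.
have t2D : 2 * t <= D * g x.
  apply: (@le_trans _ _ (2 * Lg * B / mug * g x)); last by rewrite ler_pM2r.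
  have -> : 2 * t = B * norm2 (grad g x) ^+ 2 / mug by rewrite E; field; lra.
  rewrite [leRHS]mulrAC ler_wpM2r ?invr_ge0 ?(ltW mu0)//.
  have := sqr_norm2_grad_le x Lg_gt0 g_diff g_lip g_ge0.
  by move=> /(ler_wpM2l (ltW B0)); lra.
have h2t := mul_derive0y2_le hC2 h2_nd p_ge1 h1_Theta t0.
have hD : h1 (2 * t) <= K * h1 (g x).
  by rewrite (le_trans _ (HK _ _)) ?g0//; apply: h1_nd => //; lra.
have ht : h1 t <= h1 (2 * t) by apply: h1_nd; lra.
have s1 := ler_wpM2l (ltW mu0) (le_trans h2t hD).
have s2 := ler_wpM2l (ltW Lg0) (le_trans ht hD).
lra.
Qed.

Lemma GD_composite_R_linear (x : nat -> 'rV[R]_d) :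
  GD_LFSO f L eta (fun k => norm2 (grad g (x k))) x ->
  R_linearly_to0 (fun k => norm2 (grad f (x k))).
Proof.
(* Positivity of the radii in [GD_LFSO] is what excludes stationary iterates. *)
move=> gd; have G0 k : 0 < norm2 (grad g (x k)) by case: (gd k).
have [Lg0 mu0] := (Lg_gt0, mug_gt0); have [eta0 eta2] := (eta_gt0, eta_lt2).
set b := eta * (1 - eta / 2); have b0 : 0 < b by rewrite /b mulr_gt0//; lra.
pose l k := L (x k) (rt (x k)).
have l0 k : 0 < l k by exact: L_gt0.
have step k : f (x k.+1) <= f (x k) - b / l k * norm2 (grad f (x k)) ^+ 2.
  by have [_ ->] := gd k; exact: descent_step.
clearbody b; have fdec k : f (x k) <= f (x 0%N).
  elim: k => // k; apply: le_trans; apply: le_trans (step k) _.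
  by rewrite gerBl mulr_ge0 ?sqr_ge0// divr_ge0// ltW.
have M0 := g_gt0 (G0 0%N); set M := g (x 0%N) in M0.
(* Strict monotonicity of [h] turns the decrease of [f] into a bound on [g], which makes the
   constant [A] uniform in [k]. *)
have gM k : g (x k) <= M.
  by rewrite leNgt; apply/negP => /(h_incr (ltW M0)); rewrite ltNge fdec.
have [A A0 HA] := composite_LFSO_Rtilde_le M0.
have lA k : l k <= A * h1 (g (x k)) by exact: HA.
pose e k := f (x k) - h 0.
have e_ge0 k : 0 <= e k.
  rewrite subr_ge0 /=; have := g_ge0 (x k); rewrite le_eqVlt => /predU1P[<-//|].
  by move=> /(h_incr (lexx 0))/ltW.
(* Since [e k.+1] is nonnegative, one step cannot decrease [f] by more than [e k]. *)
have N2 k : norm2 (grad f (x k)) ^+ 2 <= A * h1 M / b * e k.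
  have := step k; have := e_ge0 k.+1; rewrite /e => e1 st.
  have : b / l k * norm2 (grad f (x k)) ^+ 2 <= e k by rewrite /e; lra.
  rewrite mulrAC ler_pdivrMr// => H.
  rewrite mulrAC ler_pdivlMr// mulrC (le_trans H)// mulrC ler_wpM2r//.
  by rewrite (le_trans (lA k))// ler_pM2l//; exact: h1_nd.
(* The first entry is the contraction rate; the cap [2^-1] keeps [1 - q] positive. *)
set q := Num.min (b * (2 * mug) / A) 2^-1.
have q0 : 0 < q by rewrite /q lt_min invr_gt0 ltr0n divr_gt0 ?mulr_gt0.
have q2 : q <= 2^-1 by rewrite /q ge_min lexx orbT.
have qb : q <= b * (2 * mug) / A by rewrite /q ge_min lexx.
have contr k : e k.+1 <= (1 - q) * e k.
  suff : q * e k <= b / l k * norm2 (grad f (x k)) ^+ 2.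
    by have := step k; rewrite /e; lra.
  set t := g (x k); set G := norm2 (grad g (x k)).
  have t0 : 0 < t by exact: g_gt0.
  have h10 := h1_gt0 t0.
  have et : e k <= t * h1 t.
    exact: (sub_le_derive0y hC2 h2_nd p_ge1 h1_Theta (ltW t0)).
  (* PL read as a lower bound on the gradient: with [l k <= A * h1 t], the decrease is at least
     [b * h1 t / A * G ^+ 2], hence at least a multiple of [t * h1 t >= e k]. *)
  have tG : 2 * mug * t <= G ^+ 2.
    have := g_PL (x k); rewrite -/t -/G mulrC ler_pdivlMr ?mulr_gt0//.
    by rewrite mulrC.
  apply: (@le_trans _ _ (b * (2 * mug) / A * (t * h1 t))).
    by apply: ler_pM => //; exact: ltW.
  rewrite norm2_gradf -/t -/G.
  apply: (@le_trans _ _ (b / (A * h1 t) * (h1 t * G) ^+ 2)); last first.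
    rewrite ler_wpM2r ?sqr_ge0// ler_wpM2l ?(ltW b0)//.
    by rewrite lef_pV2 ?lA// posrE// mulr_gt0.
  have -> : b / (A * h1 t) * (h1 t * G) ^+ 2 = b * h1 t / A * G ^+ 2.
    by field; rewrite !gt_eqF.
  have -> : b * (2 * mug) / A * (t * h1 t) = b * h1 t / A * (2 * mug * t).
    by field; lra.
  by rewrite ler_wpM2l// divr_ge0 ?mulr_ge0// ltW.
have ek k : e k <= e 0%N * (1 - q) ^+ k.
  elim: k => [|k IH]; first by rewrite expr0 mulr1.
  rewrite (le_trans (contr k))// exprS mulrCA ler_wpM2l//; lra.
apply: (@R_linearly_to0_sqr _ _ (A * h1 M / b * e 0%N) (1 - q)); first lra.
move=> k; rewrite (le_trans (N2 k))// -[leRHS]mulrA ler_wpM2l//.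
by rewrite divr_ge0 ?mulr_ge0 ?h1_ge0// ltW.
Qed.

End Descent.

End CompositeOracle.

Theorem theorem4p5 (R : realType) (d : nat) (g : 'rV[R]_d -> R) (h : R -> R)
    (Lg mug p : R) (xstar : 'rV[R]_d)
    (Lg_gt0 : 0 < Lg) (mug_gt0 : 0 < mug)
    (gC2 : twice_continuously_differentiable g)
    (g_lip : lipschitz2 Lg (grad g))
    (g_PL : PL mug g)
    (xstar_min : forall x, g xstar <= g x) (g_xstar : g xstar = 0)
    (hC2 : twice_continuously_differentiable0y h)
    (h_incr : strictly_increasing0y h)
    (h_cvx : strictly_convex0y h)
    (h2_nd : nondecreasing0y (derive0y (derive0y h)))
    (p_ge1 : 1 <= p)
    (h1_Theta : Theta_pow0 p (derive0y h)) :
  let f := h \o g in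
  let L := composite_LFSO h g Lg mug in
  is_LFSO f L /\
  forall (eta : R) (x : nat -> 'rV[R]_d), 0 < eta -> eta < 2 ->
    GD_LFSO f L eta (fun k => norm2 (grad g (x k))) x ->
    R_linearly_to0 (fun k => norm2 (grad f (x k))).
Proof.
have g_diff : forall x, differentiable g x by case: gC2.
have g_ge0 x : 0 <= g x by rewrite -g_xstar.
split; first exact: (composite_is_LFSO Lg_gt0 mug_gt0 g_diff g_lip g_PL g_ge0
  hC2 h2_nd p_ge1 h1_Theta).
move=> eta x eta_gt0 eta_lt2.
exact: (GD_composite_R_linear Lg_gt0 mug_gt0 g_diff g_lip g_PL g_ge0
  hC2 h_incr h2_nd p_ge1 h1_Theta eta_gt0 eta_lt2).
Qed.
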